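(* Let $G=(V,E)$ be a finite simple connected graph. For fixed probability density vectors $\mu,\nu:V\to\mathbb{R}$, if $X\subseteq\mathcal{T}(G)$ is a basin of the function $T\mapsto\mathcal{W}_T(\mu,\nu)$ on the spanning tree state graph $\mathbb{T}(G)$ at level $c\in\mathbb{R}$, then $c=\mathcal{W}_G(\mu,\nu)$.
   Context: A probability density vector on $V$ is a nonnegative function on $V$ summing to $1$. For a connected graph $H$ on vertex set $V$ with shortest path metric $d_H$ (unit edge lengths), $\mathcal{W}_H(\mu,\nu)=\inf_{\pi\in\Pi(\mu,\nu)}\sum_{x,y\in V}\pi(x,y)d_H(x,y)$, where $\Pi(\mu,\nu)\subseteq\mathbb{R}^{V\times V}$ is the set of couplings of $\mu$ and $\nu$. A spanning tree of $G$ is a set $T\subseteq E$ such that $(V,T)$ is connected and acyclic; $\mathcal{T}(G)$ is the set of spanning trees, and $\mathcal{W}_T$ means $\mathcal{W}_{(V,T)}$. The spanning tree state graph $\mathbb{T}=\mathbb{T}(G)$ has node set $\mathcal{T}(G)$, and two distinct spanning trees $S,T$ are adjacent ($S\sim T$) iff they differ by a single edge exchange, i.e. $S=(T\cup\{f\})\setminus\{e\}$ for some $f\in E\setminus T$, $e\in T$. Given $g:\mathcal{T}(G)\to\mathbb{R}$ and $c\in\mathbb{R}$, a nonempty subset $X\subseteq\mathcal{T}(G)$ is a basin of $g$ on $\mathbb{T}$ at level $c$ if (i) the induced subgraph $\mathbb{T}[X]$ is connected, (ii) $g(T)=c$ for each $T\in X$, and (iii) $g(S)>c$ for each $S\in\partial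 X$, where $\partial X=\{S\in\mathcal{T}(G)\setminus X:\exists\,T\in X,\ S\sim T\}$. *)

(* Defs.v *)
From mathcomp Require Import all_boot all_order all_algebra.
From mathcomp Require Import classical_sets reals.

Set Implicit Arguments.
Unset Strict Implicit.
Unset Printing Implicit Defensive.

Import Order.TTheory GRing.Theory Num.Theory.

Local Open Scope ring_scope.

(* A graph on the vertex set V is identified with its set of edges, an edge
   being the set of its two endpoints.  A subset of the edges of G is thus
   again a graph on V, which is how spanning trees are represented. *)
Section Graphs.
Variable V : finType.
Implicit Types (E T : {set {set V}}) (x y : V).

Definition simple_graph E : Prop := forall f, f \in E -> #|f| = 2%N.

Definition adj E : rel V := fun x y => [set x; y]%SET \in E.

Definition connected_graph E : Prop := forall x y, connect (adj E) x y.

(* [ucycle] allows the degenerate cycles of length at most 2, hence the bound;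
   in a simple graph, the duplicate-free cycles of length at least 3 are
   exactly the cycles of graph theory. *)
Definition acyclic_graph E : Prop :=
  forall c : seq V, ucycle (adj E) c -> (size c < 3)%N.

Definition spanning_tree E T : Prop :=
  [/\ T \subset E, connected_graph T & acyclic_graph T].

Definition walk E x y n : bool :=
  [exists p : n.-tuple V, path (adj E) x p && (last x p == y)].

(* The least n such that there is a walk with n edges from x to y.  A shortest
   walk has fewer than #|V| edges, so it suffices to search n < #|V|; the value
   is #|V| when x and y are not connected. *)
Definition dist E x y : nat := find (walk E x y) (iota 0 #|V|).

Lemma dist_walk E x y : connect (adj E) x y -> walk E x y (dist E x y).
Proof.
case/connectP=> p0 /shortenP[p Ep Up _] ->.
have lt_pV : (size p < #|V|)%N by have := card_uniqP Up => /= <-; exact: max_card.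
have hasw : has (walk E x (last x p)) (iota 0 #|V|).
  apply/hasP; exists (size p); first by rewrite mem_iota.
  by apply/existsP; exists (in_tuple p); rewrite Ep eqxx.
have := nth_find 0%N hasw; rewrite nth_iota //.
by move: hasw; rewrite has_find size_iota.
Qed.

Lemma dist_le E x (p : seq V) :
  path (adj E) x p -> (dist E x (last x p) <= size p)%N.
Proof.
move=> Ep; rewrite leqNgt; apply/negP => lt_pd.
have := before_find 0%N lt_pd; rewrite nth_iota ?add0n; last first.
  by apply: leq_trans lt_pd _; rewrite -[leqRHS](size_iota 0); apply: find_size.
by move/existsP; apply; exists (in_tuple p); rewrite Ep eqxx.
Qed.

Definition exchange E : rel {set {set V}} := fun S T =>
  (S != T) &&
  [exists f in E :\: T, exists e in T, S == (T :|: [set f]%SET) :\: [set e]%SET].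

Definition boundary E (X : {set {set {set V}}}) (S : {set {set V}}) : Prop :=
  [/\ spanning_tree E S, S \notin X & exists2 T, T \in X & exchange E S T].

End Graphs.

Section Transport.
Variables (R : realType) (V : finType).
Implicit Types (E : {set {set V}}) (mu nu : V -> R).

Definition density mu : Prop := (forall x, 0 <= mu x) /\ \sum_x mu x = 1.

Definition coupling mu nu (pi : V -> V -> R) : Prop :=
  [/\ forall x y, 0 <= pi x y,
      forall x, \sum_y pi x y = mu x
    & forall y, \sum_x pi x y = nu y].

Definition wasserstein E mu nu : R :=
  inf [set w | exists2 pi, coupling mu nu pi &
                 w = \sum_x \sum_y pi x y * (dist E x y)%:R]%classic.

(* The values of g outside the spanning trees of E are irrelevant. *)
Definition basin E (g : {set {set V}} -> R) (c : R) (X : {set {set {set V}}}) :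
    Prop :=
  [/\ X != finset.set0,
      forall T, T \in X -> spanning_tree E T,
      forall S T, S \in X -> T \in X ->
        connect [rel A B | [&& A \in X, B \in X & exchange E A B]] S T,
      forall T, T \in X -> g T = c
    & forall S, boundary E X S -> c < g S].

End Transport.

(* Main.v *)
Require Import Defs.
From mathcomp Require Import all_boot all_order all_algebra.
From mathcomp Require Import classical_sets reals.
From mathcomp Require Import fintype finset.
From mathcomp Require Import ring lra.


(** Why the theorem holds.

    On a connected graph, the Wasserstein cost is the minimum of the total
    amount [cost F] moved along edges by a flow [F] whose divergence is
    [b = mu - nu]: a flow is turned into a coupling of no larger cost by
    short-cutting through one vertex after another ([transshipment]).  A
    spanning tree [T] carries exactly one such flow, [tree_flow T b], whose
    value on an edge is the mass of [b] on one side of that edge; hence the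
    cost of [T] is [tree_cost T b] ([wasserstein_tree]).  So the trees are the
    bases of a linear program and edge exchanges are its pivots: the theorem
    says that the simplex method cannot get stuck on a plateau.

    The dual certificate attached to [T] is a function [phi] on the vertices
    that drops by the sign of the flow along each edge of [T].  It is
    1-Lipschitz on [T] and satisfies [\sum_v b v * phi v = tree_cost T b].  If
    [phi] is 1-Lipschitz on all of [E], then [wasserstein_dual] shows that [T]
    is as good as [E].  Otherwise some edge [xy] of [E] has
    [phi x - phi y > 1]; sending as much flow as possible through [xy], and
    withdrawing it from the tree path from [x] to [y], empties an edge of that
    path and gives a neighbour of [T] that is strictly cheaper ([pivot]).

    The strict decrease needs a nonzero flow on every edge of [T], which may
    fail.  Therefore [b] is replaced by a nearby [b'] that gives nonzero mass
    to every proper nonempty set of vertices, is sign-compatible with [b] on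
    all sets, and preserves every strict comparison between the costs of two
    trees ([generic_perturbation]).  Let [T] minimise the perturbed cost over
    the basin [X].  A neighbour of [T] strictly cheaper for [b'] would be
    outside [X] by minimality, hence strictly more expensive than [T] for [b]
    because [X] is a basin, hence strictly more expensive for [b'] as well:
    impossible.  So the potential built from the signs of the [b']-flow is
    1-Lipschitz on [E], and by sign-compatibility it certifies that [T] is
    optimal for [b] itself. *)

Set Implicit Arguments.
Unset Strict Implicit.
Unset Printing Implicit Defensive.

Import Order.TTheory GRing.Theory Num.Theory.

Local Open Scope ring_scope.

(** * Spanning trees and edge exchanges *)

Section Trees.
Variable V : finType.
Implicit Types (E S T : {set {set V}}) (x y p q u v w : V).

Lemma set2_eq x y p q :
  [set x; y]%SET = [set p; q]%SET -> (x = p /\ y = q) \/ (x = q /\ y = p).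
Proof.
move=> eq2.
have /set2P : x \in [set p; q]%SET by rewrite -eq2 set21.
have /set2P : y \in [set p; q]%SET by rewrite -eq2 set22.
have /set2P : p \in [set x; y]%SET by rewrite eq2 set21.
have /set2P : q \in [set x; y]%SET by rewrite eq2 set22.
by do 4!case=> ?; subst; auto.
Qed.

Lemma adjC T x y : adj T x y = adj T y x.
Proof. by rewrite /adj setUC. Qed.

Lemma connect_adjC T x y : connect (adj T) x y = connect (adj T) y x.
Proof. by apply: sym_connect_sym => a b; apply: adjC. Qed.

Lemma adj_del T e x y : adj (T :\ e) x y = ([set x; y]%SET != e) && adj T x y.
Proof. by rewrite /adj in_setD1. Qed.

(** The only way in which deleting an edge can break a connection is that the
    walk had to cross it, in one of its two directions. *)
Lemma connect_bypass T x y a b : connect (adj T) a b ->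
  let T' := T :\ [set x; y]%SET in
  [\/ connect (adj T') a b,
      connect (adj T') a x /\ connect (adj T') y b
    | connect (adj T') a y /\ connect (adj T') x b].
Proof.
move=> + T'; case/connectP => p + ->.
elim: p a => [|a' p IHp] a /=; first by constructor 1; apply: connect0.
case/andP=> aa' /IHp {IHp}; set b' := last a' p => IHp.
have [/set2_eq [[-> eq_a']|[-> eq_a']]|neq] :=
    eqVneq [set a; a']%SET [set x; y]%SET.
- rewrite {}eq_a' in IHp; case: IHp => [yb|[_ yb]|[_ xb]].
  + by constructor 2; rewrite connect0.
  + by constructor 2; rewrite connect0.
  + by constructor 1.
- rewrite {}eq_a' in IHp; case: IHp => [xb|[_ yb]|[_ xb]].
  + by constructor 3; rewrite connect0.
  + by constructor 1.
  + by constructor 3; rewrite connect0.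
have Taa' : connect (adj T') a a' by apply: connect1; rewrite adj_del neq.
case: IHp => [a'b|[a'x yb]|[a'y xb]].
- by constructor 1; apply: connect_trans Taa' a'b.
- by constructor 2; split=> //; apply: connect_trans Taa' a'x.
- by constructor 3; split=> //; apply: connect_trans Taa' a'y.
Qed.

Definition side T x y : {set V} :=
  [set v | connect (adj (T :\ [set x; y]%SET)) x v].

(** Every edge is a bridge: unlike the absence of cycles, this form gives
    directly the two sides of an edge on which flows and potentials are built,
    and is checked edge by edge after an exchange. *)
Definition tree T : Prop :=
  connected_graph T /\ forall x y, adj T x y -> y \notin side T x y.

Lemma mem_side T x y : x \in side T x y.
Proof. by rewrite inE connect0. Qed.

Lemma tree_irrefl T x y : tree T -> adj T x y -> x != y.
Proof.
by case=> _ + Txy => /(_ _ _ Txy); apply: contraNneq => <-; apply: mem_side.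
Qed.

(** A walk joining the ends of an edge without using it closes up to a cycle
    with that edge; conversely an edge of a cycle is bypassed by the rest of
    the cycle. *)
Lemma spanning_treeP E T : simple_graph E ->
  spanning_tree E T <-> T \subset E /\ tree T.
Proof.
move=> simpleE; split=> [[sTE conT acyT]|[sTE [conT bridgeT]]]; last first.
  (* In a cycle x, y, z, ..., the part after y avoids the edge xy. *)
  split=> // -[|x [|y c]] //; case/andP=> /= /andP[Txy pathc].
  case/and3P=> xyc yc uc.
  case: c pathc xyc yc uc => // z c pathc xyc yc uc; exfalso.
  have /negP := bridgeT _ _ Txy; apply.
  rewrite inE connect_adjC; apply/connectP.
  exists (rcons (z :: c) x); last by rewrite last_rcons.
  move: pathc; rewrite /= !adj_del => /andP[-> pathc]; rewrite andbT.
  have x_notin : x \notin z :: c by move: xyc; rewrite inE negb_or => /andP[].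
  have yz : [set y; z]%SET != [set x; y]%SET.
    apply/eqP => /set2_eq [[yx _]|[_ zx]].
      by move: xyc; rewrite yx mem_head.
    by move: x_notin; rewrite zx mem_head.
  rewrite yz /= {yz}.
  elim: c z pathc yc x_notin {xyc uc} => [|z' c IHc] z /=.
    rewrite adj_del !andbT => -> yz xz; rewrite andbT; apply/eqP => /set2_eq.
    by case=> -[zx zy]; move: yz xz; rewrite zx ?zy !inE eqxx.
  case/andP=> zz' pathc yc xc; rewrite adj_del zz' andbT.
  rewrite IHc //; last 2 first.
  - by move: yc; rewrite inE negb_or => /andP[].
  - by move: xc; rewrite inE negb_or => /andP[].
  rewrite andbT; apply/eqP => /set2_eq [] [zx zy].
    by move: xc; rewrite zx mem_head.
  by move: yc; rewrite zx mem_head.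
split=> //; split=> // x y Txy; rewrite inE; apply/negP => /connectP[p0].
case/shortenP=> p pathp up _ eq_y.
have sTT : subrel (adj (T :\ [set x; y]%SET)) (adj T).
  by move=> a b; rewrite adj_del => /andP[].
have /acyT : ucycle (adj T) (x :: p).
  rewrite /ucycle up andbT /= rcons_path (sub_path sTT pathp) /=.
  by rewrite -eq_y adjC.
have := simpleE _ (subsetP sTE _ Txy); rewrite cards2.
case: p pathp eq_y {up} => [|z [|//]] /= => [_ ->|]; first by rewrite eqxx.
by rewrite adj_del andbT => /andP[zy _] eq_y; rewrite eq_y eqxx in zy.
Qed.

(** Connectedness makes the two sides cover [V], and the bridge property makes
    them disjoint. *)
Lemma sideC T x y : tree T -> adj T x y -> side T y x = ~: side T x y.
Proof.
case=> conT bridgeT Txy; apply/setP => v; rewrite in_setC !inE.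
rewrite [[set y; x]%SET]setUC; apply/idP/idP => [yv|xv].
  have := bridgeT _ _ Txy; rewrite inE; apply: contra => xv.
  by apply: connect_trans xv _; rewrite connect_adjC.
case: (connect_bypass x y (conT x v)) => [xv'|[]//|[_ xv']].
  by rewrite xv' in xv.
by rewrite xv' in xv.
Qed.

Lemma side_edge T x y p q : adj T p q -> [set p; q]%SET != [set x; y]%SET ->
  (p \in side T x y) = (q \in side T x y).
Proof.
move=> Tpq neq; rewrite !inE; apply: same_connect_r.
  by move=> a b; apply: connect_adjC.
by apply: connect1; rewrite adj_del neq.
Qed.

(** A tree remains a tree when an edge [uw] is replaced by an edge [xy] that
    reconnects the two sides of [uw].  Another edge [ab] stays a bridge: a walk
    bypassing it would have to use [xy], and together with [ab] it would then
    join [x] to [y] without [uw]. *)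
Lemma exchange_tree T x y u w : tree T -> adj T u w -> ~~ adj T x y ->
  x \in side T u w -> y \notin side T u w ->
  tree ((T :|: [set [set x; y]%SET]) :\ [set u; w]%SET).
Proof.
move=> treeT Tuw nTxy xuw yuw; set S := _ :\ _; set e := [set u; w]%SET.
have [conT bridgeT] := treeT.
have neq_fe : [set x; y]%SET != e.
  by apply: contraNneq nTxy; rewrite /adj => ->.
have Sxy : adj S x y by rewrite /adj !inE neq_fe eqxx orbT.
have subTS : subrel (connect (adj (T :\ e))) (connect (adj S)).
  apply: connect_sub => a b; rewrite adj_del => /andP[neq Tab].
  by apply: connect1; rewrite adj_del neq; move: Tab; rewrite /adj inE => ->.
have wy : connect (adj (T :\ e)) w y.
  have : y \in side T w u by rewrite (sideC treeT Tuw) in_setC.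
  by rewrite inE [[set w; u]%SET]setUC.
have ux : connect (adj (T :\ e)) u x by rewrite inE in xuw.
have nxy : ~~ connect (adj (T :\ e)) x y.
  move: yuw; rewrite inE; apply: contra; exact: connect_trans.
split=> [a b|a b].
  apply: (connect_sub _ (conT a b)) => p q Tpq.
  have [/set2_eq [[-> ->]|[-> ->]]|neq] := eqVneq [set p; q]%SET e.
  - apply: connect_trans (subTS _ _ ux) _.
    by apply: connect_trans (connect1 Sxy) _; rewrite connect_adjC subTS.
  - rewrite connect_adjC; apply: connect_trans (subTS _ _ ux) _.
    by apply: connect_trans (connect1 Sxy) _; rewrite connect_adjC subTS.
  - by apply/subTS/connect1; rewrite adj_del neq.
rewrite {1}/S adj_del => /andP[neq]; rewrite /adj !inE.
have delS g : (S :\ g) :\ [set x; y]%SET \subset (T :\ e) :\ g.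
  by apply/subsetP => h; rewrite !inE; case: (h == _); rewrite /= ?andbF ?orbF.
have sub_connect (A B : {set {set V}}) : A \subset B ->
    subrel (connect (adj A)) (connect (adj B)).
  move=> sAB; apply: connect_sub => p q Apq; apply: connect1.
  exact: subsetP sAB _ Apq.
have [/eqP eqf _|neqf] := boolP ([set a; b]%SET == [set x; y]%SET).
  have -> : S :\ [set a; b]%SET = T :\ e.
    apply/setP=> h; rewrite eqf !inE; have [->|] := eqVneq h [set x; y]%SET.
      by rewrite -[_ \in T]/(adj T x y) (negPf nTxy) andbF.
    by rewrite orbF.
  case: (set2_eq eqf) => -[-> ->] //; by rewrite connect_adjC.
rewrite orbF => Tab; apply/negP.
move/(connect_bypass x y) => /= cases.
have eab : connect (adj (T :\ e)) a b by apply: connect1; rewrite adj_del neq.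
have del1 : subrel (connect (adj ((T :\ e) :\ [set a; b]%SET)))
                   (connect (adj (T :\ e))).
  exact/sub_connect/subD1set.
have del2 : subrel (connect (adj ((T :\ e) :\ [set a; b]%SET)))
                   (connect (adj (T :\ [set a; b]%SET))).
  by apply: sub_connect; apply/setSD/subD1set.
have{delS} delS := sub_connect _ _ (delS [set a; b]%SET).
case: cases => [/delS/del2 ab|[/delS/del1 ax /delS/del1 yb]
               |[/delS/del1 ay /delS/del1 xb]].
- by have := bridgeT _ _ Tab; rewrite inE ab.
- case/negP: nxy; apply: connect_trans (_ : connect _ x a) _.
    by rewrite connect_adjC.
  by apply: connect_trans eab _; rewrite connect_adjC.
- case/negP: nxy; apply: connect_trans xb _.
  by apply: connect_trans ay; rewrite connect_adjC.
Qed.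

End Trees.

(** * Flows and potentials on a tree *)

Section Flows.
Variables (R : realFieldType) (V : finType).
Implicit Types (S T : {set {set V}}) (A : {set V}) (x y p q u v w : V).
Implicit Types (b phi : V -> R) (s F : V -> V -> R).

Definition mass b A : R := \sum_(v in A) b v.

(** [F x y] is the signed amount moved from [x] to [y], and [b] is the net
    supply at each vertex. *)
Definition flow T b F : Prop :=
  [/\ forall x y, F y x = - F x y,
      forall x y, ~~ adj T x y -> F x y = 0
    & forall x, \sum_y F x y = b x].

(** The sum runs over ordered pairs and so meets every edge twice. *)
Definition cost F : R := (\sum_x \sum_y `|F x y|) / 2.

(** Conservation forces this value: what crosses [xy] is exactly the supply of
    the side of [x]. *)
Definition tree_flow T b x y : R :=
  if adj T x y then mass b (side T x y) else 0.

Definition tree_cost T b : R := cost (tree_flow T b).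

(** For antisymmetric [s], a function on [V] that drops by [s x y] along each
    edge [xy] of [T], as a combination of indicators of sides; each edge
    contributes from its two orientations. *)
Definition potential T s v : R :=
  (\sum_x \sum_y s x y * (v \in side T x y)%:R) / 2.

Lemma sum_deltaM x (f : V -> R) : \sum_v (v == x)%:R * f v = f x.
Proof.
rewrite (bigD1 x) //= eqxx mul1r big1 ?addr0 // => v /negPf->.
by rewrite mul0r.
Qed.

Lemma sum_delta x : \sum_v (v == x)%:R = 1 :> R.
Proof.
rewrite -[RHS](sum_deltaM x (fun=> 1)).
by apply: eq_bigr => v _; rewrite mulr1.
Qed.

Lemma massE b A : mass b A = \sum_v b v * (v \in A)%:R.
Proof.
rewrite /mass big_mkcond; apply: eq_bigr => v _.
by case: ifP; rewrite ?mulr1 ?mulr0.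
Qed.

Lemma massC b A : \sum_v b v = 0 -> mass b (~: A) = - mass b A.
Proof.
move=> b0; apply/eqP; rewrite -addr_eq0 -b0 (bigID [in A]) /= addrC /mass.
by apply/eqP; congr (_ + _); apply: eq_bigl => v; rewrite in_setC.
Qed.

Lemma massDl b1 b2 (e : R) A :
  mass (fun v => b1 v + e * b2 v) A = mass b1 A + e * mass b2 A.
Proof. by rewrite /mass big_split mulr_sumr. Qed.

Lemma mass_delta x y A :
  mass (fun v => (v == x)%:R - (v == y)%:R) A = (x \in A)%:R - (y \in A)%:R.
Proof.
have delta z : mass (fun v => (v == z)%:R) A = (z \in A)%:R.
  by rewrite massE sum_deltaM.
by rewrite {1}/mass sumrB -!/(mass _ A) !delta.
Qed.

(** The ends of an edge lie on the same side of every other edge, so only the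
    terms of the edge itself survive. *)
Lemma potential_edge T s p q : tree T -> (forall x y, s y x = - s x y) ->
  adj T p q -> potential T s p - potential T s q = s p q.
Proof.
move=> treeT sN Tpq; have [_ bridgeT] := treeT; rewrite /potential -mulrBl.
have npq := tree_irrefl treeT Tpq.
have Tqp : adj T q p by rewrite adjC.
have two : (2%:R : R) != 0 by rewrite pnatr_eq0.
apply: (canLR (mulfK two)); rewrite !pair_big -sumrB.
rewrite (bigD1 (p, q)) // (bigD1 (q, p)) /=; last first.
  by rewrite xpair_eqE negb_and eq_sym npq.
rewrite !mem_side (negPf (bridgeT _ _ Tpq)) (negPf (bridgeT _ _ Tqp)).
rewrite big1 => [|[x y] /= /andP[npq1 npq2]].
  by rewrite (sN p q) /=; ring.
have [/set2_eq [] [px qy]|neq] := eqVneq [set p; q]%SET [set x; y]%SET.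
- by rewrite px qy eqxx in npq1.
- by rewrite px qy eqxx in npq2.
by rewrite (side_edge Tpq neq) subrr.
Qed.

(** Potentials and tree flows are adjoint: exchanging the sums turns the
    indicators of the sides into masses. *)
Lemma potential_pairing T s b :
  \sum_v b v * potential T s v =
  (\sum_x \sum_y s x y * mass b (side T x y)) / 2.
Proof.
rewrite mulr_suml; under [LHS]eq_bigr do rewrite mulrA mulr_sumr mulr_suml.
rewrite exchange_big; apply: eq_bigr => x _ /=; rewrite mulr_suml.
under eq_bigr do rewrite mulr_sumr mulr_suml.
rewrite exchange_big; apply: eq_bigr => y _ /=.
rewrite massE mulr_sumr mulr_suml.
by apply: eq_bigr => v _; ring.
Qed.

Lemma eq_tree T f : connected_graph T ->
  (forall p q, adj T p q -> f p = f q :> R) -> forall p q, f p = f q.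
Proof.
move=> conT eqf p q; have /connectP[c + ->] := conT p q.
elim: c p => //= p1 c IHc p /andP[/eqf-> pc]; exact: IHc.
Qed.

Lemma tree_flowN T b x y : tree T -> \sum_v b v = 0 ->
  tree_flow T b y x = - tree_flow T b x y.
Proof.
move=> treeT b0; rewrite /tree_flow [adj T y x]adjC; case: ifP => [Txy|_].
  by rewrite (sideC treeT Txy) massC.
by rewrite oppr0.
Qed.

(** That the side masses satisfy conservation at [z] is obtained by duality:
    the indicator of [z] is, up to a constant, the potential of its own
    differences along the edges, and pairing it with [b] gives [b z] on one
    hand and, by [potential_pairing], the divergence of [tree_flow] at [z] on
    the other hand. *)
Lemma tree_flowP T b : tree T -> \sum_v b v = 0 -> flow T b (tree_flow T b).
Proof.
move=> treeT b0; have tN x y := tree_flowN x y treeT b0.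
split=> // [x y|z]; first by rewrite /tree_flow => /negPf->.
pose delta v : R := (v == z)%:R.
have sumdelta (f : V -> R) : \sum_v delta v * f v = f z := sum_deltaM z f.
pose s x y : R := if adj T x y then delta x - delta y else 0.
have sN x y : s y x = - s x y.
  by rewrite /s [adj T y x]adjC; case: ifP; rewrite ?oppr0 ?opprB.
have bz f : \sum_v b v * f v = \sum_v b v * (f v - f z).
  under [RHS]eq_bigr do rewrite mulrBr.
  by rewrite sumrB -mulr_suml b0 mul0r subr0.
have potE v : potential T s v - potential T s z = delta v - delta z.
  suff: potential T s v - delta v = potential T s z - delta z by lra.
  apply: (eq_tree (f := fun u => potential T s u - delta u) treeT.1) => p q Tpq.
  by have := potential_edge treeT sN Tpq; rewrite {3}/s Tpq; lra.
have: \sum_v b v * delta v = \sum_v b v * potential T s v.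
  by rewrite bz [RHS]bz; apply: eq_bigr => v _; rewrite potE.
under eq_bigr do rewrite mulrC; rewrite sumdelta potential_pairing => ->.
have -> : \sum_x \sum_y s x y * mass b (side T x y) =
    \sum_x \sum_y (delta x * tree_flow T b x y - delta y * tree_flow T b x y).
  apply: eq_bigr => x _; apply: eq_bigr => y _; rewrite /s /tree_flow.
  by case: ifP => _; ring.
under [in RHS]eq_bigr do rewrite sumrB -mulr_sumr sumdelta.
rewrite sumrB sumdelta.
have -> : \sum_i tree_flow T b i z = - \sum_i tree_flow T b z i.
  by rewrite -sumrN; apply: eq_bigr => i _; apply: tN.
lra.
Qed.

Lemma flow_pairing T b F phi : flow T b F ->
  \sum_v b v * phi v = (\sum_x \sum_y F x y * (phi x - phi y)) / 2.
Proof.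
case=> FN _ Fb.
have -> : \sum_v b v * phi v = \sum_x \sum_y F x y * phi x.
  by apply: eq_bigr => v _; rewrite -Fb mulr_suml.
have eqN : \sum_x \sum_y F x y * phi y = - \sum_x \sum_y F x y * phi x.
  rewrite exchange_big -sumrN; apply: eq_bigr => y _; rewrite -sumrN.
  by apply: eq_bigr => x _; rewrite FN; ring.
under [in RHS]eq_bigr do under eq_bigr do rewrite mulrBr.
under [in RHS]eq_bigr do rewrite sumrB.
by rewrite sumrB eqN; lra.
Qed.

(** Moving one unit along an edge costs 1 and gains at most 1 in potential. *)
Lemma weak_duality T b F phi : flow T b F ->
  (forall x y, adj T x y -> `|phi x - phi y| <= 1) ->
  \sum_v b v * phi v <= cost F.
Proof.
move=> flowF lip; rewrite (flow_pairing phi flowF) ler_pM2r ?invr_gt0 ?ltr0n //.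
apply: ler_sum => x _; apply: ler_sum => y _; apply: le_trans (ler_norm _) _.
rewrite normrM; have [Txy|nTxy] := boolP (adj T x y).
  by rewrite ler_piMr ?lip.
by case: flowF => _ -> // _; rewrite normr0 mul0r.
Qed.

(** The signs [s] need not come from [b]: any choice compatible with its flow
    gives a potential that attains the cost, which is what allows a certificate
    built for a perturbation of [b] to be used for [b]. *)
Lemma tree_cost_potential T s b :
  (forall x y, s x y * mass b (side T x y) = `|tree_flow T b x y|) ->
  \sum_v b v * potential T s v = tree_cost T b.
Proof.
move=> sE; rewrite potential_pairing; congr (_ / _).
by apply: eq_bigr => x _; apply: eq_bigr.
Qed.

Definition flow_sign T b x y : R := Num.sg (tree_flow T b x y).

Lemma flow_signN T b x y : tree T -> \sum_v b v = 0 ->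
  flow_sign T b y x = - flow_sign T b x y.
Proof.
by move=> treeT b0; rewrite /flow_sign (tree_flowN x y treeT b0) sgrN.
Qed.

Lemma flow_sign_cost T b :
  \sum_v b v * potential T (flow_sign T b) v = tree_cost T b.
Proof.
apply: tree_cost_potential => x y; rewrite /flow_sign /tree_flow.
by case: ifP => _; rewrite ?sgr0 ?mul0r ?normr0 // normrEsg.
Qed.

Lemma flow_sign_lip T b x y : tree T -> \sum_v b v = 0 -> adj T x y ->
  `|potential T (flow_sign T b) x - potential T (flow_sign T b) y| <= 1.
Proof.
move=> treeT b0 Txy; rewrite potential_edge // => [|p q].
  by rewrite /flow_sign normr_sg lern1 leq_b1.
exact: flow_signN.
Qed.

(** The potential of the tree bounds the cost of every flow on it from below,
    so the flow after a pivot can be compared with the new tree without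
    computing the new side masses. *)
Lemma tree_cost_le T b F : tree T -> \sum_v b v = 0 -> flow T b F ->
  tree_cost T b <= cost F.
Proof.
move=> treeT b0 flowF; rewrite -flow_sign_cost; apply: weak_duality flowF _.
by move=> x y; apply: flow_sign_lip.
Qed.

Lemma cost_triangle F G (e : R) : 0 <= e ->
  cost (fun x y => F x y + e * G x y) <= cost F + e * cost G.
Proof.
move=> e0; rewrite /cost mulrA -mulrDl ler_pM2r ?invr_gt0 ?ltr0n //.
rewrite mulr_sumr -big_split; apply: ler_sum => x _.
rewrite mulr_sumr -big_split; apply: ler_sum => y _.
by apply: le_trans (ler_normD _ _) _; rewrite normrM (ger0_norm e0).
Qed.

End Flows.

(** * The pivot step *)

Section Pivot.
Variables (R : realFieldType) (V : finType).
Implicit Types (S T : {set {set V}}) (A : {set V}) (x y p q u v w : V).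
Implicit Types (b phi : V -> R) (s F : V -> V -> R).

Definition edge_flow x y : V -> V -> R := fun p q =>
  ((p == x) && (q == y))%:R - ((p == y) && (q == x))%:R.

Lemma sum_delta2 p x y : \sum_q ((p == x) && (q == y))%:R = (p == x)%:R :> R.
Proof.
under eq_bigr do rewrite -mulnb natrM.
by rewrite -mulr_sumr sum_delta mulr1.
Qed.

Lemma edge_flowP T x y : adj T x y ->
  flow T (fun v => (v == x)%:R - (v == y)%:R) (edge_flow x y).
Proof.
move=> Txy; split=> [p q|p q|p].
- by rewrite /edge_flow opprB andbC [in X in _ - X]andbC.
- have [/andP[/eqP-> /eqP->]|n1] := boolP ((p == x) && (q == y)).
    by rewrite Txy.
  have [/andP[/eqP-> /eqP->]|n2 _] := boolP ((p == y) && (q == x)).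
    by rewrite adjC Txy.
  by rewrite /edge_flow (negPf n1) (negPf n2) subrr.
- by rewrite sumrB !sum_delta2.
Qed.

Lemma cost_edge_flow x y : cost (edge_flow x y) <= 1.
Proof.
rewrite /cost ler_pdivrMr ?ltr0n // mul1r.
have le p q : `|edge_flow x y p q| <=
    ((p == x) && (q == y))%:R + ((p == y) && (q == x))%:R.
  apply: le_trans (ler_normB _ _) _; by rewrite !normr_nat.
apply: (@le_trans _ _ (\sum_p ((p == x)%:R + (p == y)%:R))).
  apply: ler_sum => p _.
  apply: (@le_trans _ _ (\sum_q (((p == x) && (q == y))%:R
                                 + ((p == y) && (q == x))%:R))).
    by apply: ler_sum => q _.
  by rewrite big_split /= !sum_delta2.
by rewrite big_split /= !sum_delta -[2%:R]/(1 + 1).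
Qed.

(** Withdrawing [t] units of one flow and sending them along another flow with
    the same divergence. *)
Lemma flow_pushed T S b d F P D (t : R) :
  flow T b F -> flow T d P -> flow S d D ->
  flow (T :|: S) b (fun p q => F p q - t * P p q + t * D p q).
Proof.
case=> [FN F0 Fb] [PN P0 Pd] [DN D0 Dd]; split=> [p q|p q|p].
- by rewrite FN PN DN; ring.
- rewrite /adj inE negb_or => /andP[nT nS].
  by rewrite F0 // P0 // D0 //; ring.
- by rewrite big_split sumrB /= -!mulr_sumr Fb Pd Dd; ring.
Qed.

(** One step of the simplex method.  Let [P] be the unit flow from [x] to [y]
    in [T], with values in {-1, 0, 1}.  Pushing [t] units from the tree path to
    the edge [xy] changes the cost by [t * (1 - (phi x - phi y)) < 0], as long
    as [t] is at most the flow on each path edge where it runs in the direction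
    of [P]; the minimum of these flows empties the edge [uw] that attains it. *)
Lemma pivot T b x y : tree T -> \sum_v b v = 0 ->
  (forall u w, adj T u w -> tree_flow T b u w != 0) -> ~~ adj T x y ->
  let phi := potential T (flow_sign T b) in 1 < phi x - phi y ->
  exists u w, let S := (T :|: [set [set x; y]%SET]) :\ [set u; w]%SET in
    [/\ adj T u w, tree S & tree_cost S b < tree_cost T b].
Proof.
move=> treeT b0 Fneq0 nTxy phi gt1.
pose d : V -> R := fun v => (v == x)%:R - (v == y)%:R.
have d0 : \sum_v d v = 0 by rewrite /d sumrB !sum_delta subrr.
have flowF := tree_flowP treeT b0; set F := tree_flow T b in flowF.
have flowP := tree_flowP treeT d0; set P := tree_flow T d in flowP.
have flowD : flow [set [set x; y]%SET] d (edge_flow x y).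
  by apply: edge_flowP; rewrite /adj inE.
have [FN F0 _] := flowF; have [PN P0 _] := flowP.
have P3 u w : [\/ P u w = 0, P u w = 1 | P u w = -1].
  rewrite /P /tree_flow; case: ifP => _; last by constructor 1.
  rewrite mass_delta; case: (_ \in _); case: (_ \in _).
  - by constructor 1; rewrite subrr.
  - by constructor 2; rewrite subr0.
  - by constructor 3; rewrite sub0r.
  - by constructor 1; rewrite subrr.
have gapE : phi x - phi y =
    (\sum_u \sum_w flow_sign T b u w * P u w) / 2.
  transitivity (\sum_v d v * phi v).
    under eq_bigr do rewrite mulrBl.
    by rewrite sumrB !sum_deltaM.
  rewrite potential_pairing; congr (_ / _); apply: eq_bigr => u _.
  apply: eq_bigr => w _; rewrite /flow_sign /P /tree_flow.
  by case: ifP => _; rewrite ?sgr0 ?mul0r.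
(* Q selects the path edges whose flow runs from x towards y. *)
pose Q : pred (V * V) := fun e => (0 < F e.1 e.2) && (P e.1 e.2 == 1).
(* Without such an edge, phi could not decrease from x to y. *)
have [e0 Qe0] : exists e, Q e.
  apply/existsP; apply: contraTT gt1; rewrite negb_exists => /forallP nQ.
  rewrite -leNgt gapE; apply: le_trans ler01.
  rewrite pmulr_lle0 ?invr_gt0 ?ltr0n //.
  apply: sumr_le0 => u _; apply: sumr_le0 => w _; rewrite /flow_sign -/F.
  have := nQ (u, w); have := nQ (w, u); rewrite /Q /= [F w u]FN [P w u]PN.
  case: (P3 u w) => ->.
  - by rewrite mulr0.
  - by rewrite eqxx andbT mulr1 -leNgt sgr_le0.
  - rewrite opprK eqxx andbT mulrN1 oppr_le0 sgr_ge0 -leNgt oppr_le0.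
    by [].
case: (Order.TotalTheory.arg_minP (fun e => F e.1 e.2) Qe0) => -[u w].
rewrite /Q /= => /andP[Fuw0 /eqP Puw] t_min; set t := F u w in Fuw0 t_min.
have Tuw : adj T u w.
  by apply: contraTT Fuw0 => /F0; rewrite /t => ->; rewrite ltxx.
exists u, w; set S := _ :\ _.
have [xuw yuw] : x \in side T u w /\ y \notin side T u w.
  move: Puw; rewrite /P /tree_flow Tuw mass_delta.
  case: (x \in _); case: (y \in _); rewrite ?subrr ?sub0r => //= /eqP.
  - by rewrite eq_sym oner_eq0.
  - by rewrite -subr_eq0 -opprD oppr_eq0 -[1 + 1]/(2%:R) pnatr_eq0.
  - by rewrite eq_sym oner_eq0.
have treeS : tree S by apply: exchange_tree.
split=> //.
pose F' p q := F p q - t * P p q + t * edge_flow x y p q.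
have neq : [set u; w]%SET != [set x; y]%SET.
  by apply: contraNneq nTxy; rewrite /adj => <-.
have flowF' : flow S b F'.
  have [F'N F'0 F'b] := flow_pushed t flowF flowP flowD.
  split=> // p q nS; have [eqe|ne] := eqVneq [set p; q]%SET [set u; w]%SET.
    have [_ D0 _] := flowD.
    rewrite /F' D0 ?mulr0 ?addr0; last by rewrite /adj inE eqe.
    case/set2_eq: eqe => -[-> ->]; first by rewrite Puw mulr1 subrr.
    by rewrite FN PN Puw -/t; ring.
  by apply: F'0; apply: contra nS; rewrite adj_del ne.
apply: le_lt_trans (tree_cost_le treeS b0 flowF') _.
apply: le_lt_trans (cost_triangle _ _ (ltW Fuw0)) _.
(* On edges where P runs with the flow, t does not exceed the flow, so that
   the flow is reduced without changing sign. *)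
have step p q : `|F p q - t * P p q| <=
    `|F p q| - t * (flow_sign T b p q * P p q).
  have [Tpq|nTpq] := boolP (adj T p q); last first.
    by rewrite F0 // P0 // !mulr0 subr0 normr0 subr0.
  have := Fneq0 _ _ Tpq; rewrite -/F neq_lt /flow_sign -/F.
  case/orP=> sF; [rewrite (ltr0_sg sF) (ltr0_norm sF)
                 | rewrite (gtr0_sg sF) (gtr0_norm sF)].
    have minF : P p q = -1 -> t <= - F p q.
      move=> P1; rewrite -FN; apply: (t_min (q, p)) => /=.
      by rewrite FN oppr_gt0 sF PN P1 opprK /=.
    case: (P3 p q) => [P1|P1|/[dup] P1 /minF le_t]; rewrite P1.
    + by rewrite !mulr0 !subr0 (ltr0_norm sF).
    + by rewrite ler0_norm; lra.
    + by rewrite ler0_norm; lra.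
  have minF : P p q = 1 -> t <= F p q.
    by move=> P1; apply: (t_min (p, q)) => /=; rewrite sF P1 eqxx.
  case: (P3 p q) => [P1|/[dup] P1 /minF le_t|P1]; rewrite P1.
  + by rewrite !mulr0 !subr0 (gtr0_norm sF).
  + by rewrite ger0_norm; lra.
  + by rewrite ger0_norm; lra.
have costFP : cost (fun p q => F p q - t * P p q) <=
    tree_cost T b - t * (phi x - phi y).
  rewrite gapE mulrA -mulrBl ler_pM2r ?invr_gt0 ?ltr0n // mulr_sumr -sumrB.
  apply: ler_sum => p _; rewrite mulr_sumr -sumrB.
  by apply: ler_sum => q _.
have := cost_edge_flow x y; move: (cost (edge_flow _ _)) => cD cD1.
have : t * 1 < t * (phi x - phi y) by rewrite ltr_pM2l.
have : t * cD <= t * 1 by rewrite ler_pM2l.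
by lra.
Qed.

End Pivot.

(** * A generic perturbation of the supplies *)

Section Perturbation.
Variables (R : realFieldType) (V : finType).
Implicit Types (S T : {set {set V}}) (A : {set V}) (b : V -> R).

Lemma small_scale (I : finType) (p q : I -> R) :
  exists2 e : R, 0 < e & forall i, 0 < p i -> e * q i < p i.
Proof.
pose M := 1 + \sum_(i | 0 < p i) `|q i| / p i.
have M0 : 0 < M.
  by rewrite ltr_wpDr ?sumr_ge0 ?ltr01 // => i pi; rewrite divr_ge0 // ltW.
exists M^-1; first by rewrite invr_gt0.
move=> i pi; rewrite mulrC ltr_pdivrMr // mulrC -ltr_pdivrMr //.
apply: (@le_lt_trans _ _ (`|q i| / p i)).
  by rewrite ler_pM2r ?invr_gt0 // ler_norm.
rewrite /M (bigD1 i) //= addrCA ltrDl ltr_pwDl ?ltr01 ?sumr_ge0 //.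
move=> j /andP[pj _].
by rewrite divr_ge0 // ltW.
Qed.

Lemma tree_costD T b1 b2 (e : R) : 0 <= e ->
  `|tree_cost T (fun v => b1 v + e * b2 v) - tree_cost T b1|
    <= e * tree_cost T b2.
Proof.
move=> e0; set b3 := fun v => _.
have b3E x y : tree_flow T b3 x y = tree_flow T b1 x y + e * tree_flow T b2 x y.
  by rewrite /tree_flow; case: ifP => _; rewrite ?massDl // mulr0 addr0.
have costN : tree_cost T b2 = cost (fun x y => - tree_flow T b2 x y).
  congr (_ / _); apply: eq_bigr => x _; apply: eq_bigr => y _.
  by rewrite normrN.
rewrite ler_distl lerBlDr {1}costN; apply/andP; split.
  have -> : tree_cost T b1 =
      cost (fun x y => tree_flow T b3 x y + e * - tree_flow T b2 x y).
    congr (_ / _); apply: eq_bigr => x _; apply: eq_bigr => y _.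
    by rewrite b3E mulrN addrK.
  exact: cost_triangle.
have -> : tree_cost T b3 =
    cost (fun x y => tree_flow T b1 x y + e * tree_flow T b2 x y).
  by congr (_ / _); apply: eq_bigr => x _; apply: eq_bigr => y _; rewrite b3E.
exact: cost_triangle.
Qed.

(** The perturbation is a small multiple of the supply that is 1 everywhere,
    except at a root [r] where it absorbs the total: a set of vertices then has
    mass [#|A|] or [#|A| - #|V|], which is nonzero unless the set is empty or
    full. *)
Lemma generic_perturbation (r : V) b : \sum_v b v = 0 ->
  exists b' : V -> R,
  [/\ \sum_v b' v = 0,
      forall A, A != set0 -> A != [set: V] -> mass b' A != 0,
      forall A, Num.sg (mass b' A) * mass b A = `|mass b A|
    & forall S T, tree_cost T b < tree_cost S b ->
        tree_cost T b' < tree_cost S b'].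
Proof.
move=> b0; pose h v : R := 1 - #|V|%:R * (v == r)%:R.
have hE A : mass h A = #|A|%:R - (if r \in A then #|V|%:R else 0).
  rewrite /mass /h sumrB sumr_const; congr (_ - _).
  rewrite -mulr_sumr big_mkcond (bigD1 r) //= eqxx big1 ?addr0.
    by case: ifP; rewrite ?mulr1 ?mulr0.
  by move=> v /negPf->; case: ifP.
have h0 : \sum_v h v = 0.
  have -> : \sum_v h v = mass h [set: V].
    by rewrite /mass; apply: eq_bigl => v; rewrite inE.
  by rewrite hE inE cardsT subrr.
have hA A : A != set0 -> A != [set: V] -> mass h A != 0.
  move=> A0 AT; rewrite hE; case: ifP => _.
    rewrite subr_eq0 eqr_nat; apply: contra AT => /eqP cardA.
    by rewrite eqEcard subsetT cardsT cardA leqnn.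
  by rewrite subr0 pnatr_eq0 cards_eq0.
(* Finitely many strict inequalities have to survive: the nonvanishing of the
   masses, indexed by sets, and the cost gaps, indexed by pairs of graphs. *)
pose p (i : {set V} + {set {set V}} * {set {set V}}) : R := match i with
  | inl A => `|mass b A|
  | inr (T1, T2) => tree_cost T1 b - tree_cost T2 b
  end.
pose q (i : {set V} + {set {set V}} * {set {set V}}) : R := match i with
  | inl A => `|mass h A|
  | inr (T1, T2) => tree_cost T1 h + tree_cost T2 h
  end.
have [e e0 small] := small_scale p q.
exists (fun v => b v + e * h v); split.
- by rewrite big_split -mulr_sumr /= b0 h0 mulr0 addr0.
- move=> A A0 AT; rewrite massDl; have [->|bA] := eqVneq (mass b A) 0.
    by rewrite add0r mulf_neq0 ?hA ?gt_eqF.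
  apply: contraTneq (small (inl A) _) => /=; last by rewrite normr_gt0.
  move/eqP; rewrite addr_eq0 => /eqP->.
  by rewrite normrN normrM (gtr0_norm e0) ltxx.
- move=> A; rewrite massDl; have [->|bA] := eqVneq (mass b A) 0.
    by rewrite mulr0 normr0.
  have /= := small (inl A); rewrite normr_gt0 => /(_ bA).
  rewrite -{1}(gtr0_norm e0) -normrM ltr_norml => /andP[].
  have /orP[bA0|bA0] : (mass b A < 0) || (0 < mass b A) by rewrite -neq_lt.
    rewrite (ltr0_norm bA0) => *; rewrite ltr0_sg ?mulN1r //; lra.
  rewrite (gtr0_norm bA0) => *; rewrite gtr0_sg ?mul1r //; lra.
- move=> S T ltTS; have := small (inr (S, T)); rewrite /= subr_gt0 => /(_ ltTS).
  have := tree_costD S b h (ltW e0); have := tree_costD T b h (ltW e0).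
  rewrite !ler_distl => /andP[_ ?] /andP[? _]; lra.
Qed.

End Perturbation.

(** * From flows to couplings *)

Section Transshipment.
Variables (R : realFieldType) (V : finType).
Implicit Types (x y v : V) (mu nu : V -> R) (d gam pi : V -> V -> R).

(** A plan for moving [mu] to [nu] in which the mass may stop at intermediate
    vertices before being sent on. *)
Definition shipment mu nu gam : Prop :=
  (forall x y, 0 <= gam x y) /\
  forall x, \sum_y gam x y - \sum_y gam y x = mu x - nu x.

Definition transport_cost d pi : R := \sum_x \sum_y pi x y * d x y.

(** What passes through [v] without being supplied or consumed there is an
    amount [k].  It is taken proportionally from the shipments into and out of
    [v] ([a] and [c]), and replaced by direct shipments [a x / k * c y], whose
    cost is no larger by the triangle inequality.  The diagonal entry at [v] is
    free of charge: it is set to [dv], the part of [mu v] that stays at [v]. *)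
Lemma eliminate_vertex mu nu d gam v :
  (forall x, 0 <= mu x) -> (forall x, 0 <= nu x) ->
  (forall x, d x x = 0) -> (forall x y z, d x z <= d x y + d y z) ->
  shipment mu nu gam ->
  exists gam', [/\ shipment mu nu gam',
    transport_cost d gam' <= transport_cost d gam,
    \sum_y gam' v y = mu v
  & forall x, x != v -> \sum_y gam' x y = \sum_y gam x y].
Proof.
move=> mu0 nu0 dxx dtri [gam0 gamE].
pose inn := \sum_(x | x != v) gam x v; pose out := \sum_(y | y != v) gam v y.
have inn0 : 0 <= inn by apply: sumr_ge0.
have out0 : 0 <= out by apply: sumr_ge0.
have balance : out - inn = mu v - nu v.
  have sum_in : \sum_x gam x v = gam v v + inn by rewrite (bigD1 v).
  have sum_out : \sum_y gam v y = gam v v + out by rewrite (bigD1 v).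
  by rewrite -gamE sum_in sum_out; ring.
(* If v ships out less than its supply, nothing needs to pass through v. *)
pose k : R := Num.max 0 (out - mu v); pose dv := k + mu v - out.
have k0 : 0 <= k by rewrite le_max lexx.
have dv0 : 0 <= dv.
  by rewrite /dv /k; case: (lerP 0 (out - mu v)) => ?; have := mu0 v; lra.
have k_out : k <= out by rewrite ge_max out0 lerBlDr lerDl mu0.
have k_inn : k <= inn.
  by rewrite ge_max inn0 /=; have := nu0 v; lra.
pose a x := if x == v then 0 else gam x v * (k / inn).
pose c y := if y == v then 0 else gam v y * (k / out).
have frac z : 0 <= z -> k <= z -> 0 <= k / z <= 1.
  move=> z0 kz; rewrite divr_ge0 //=; have [->|zn0] := eqVneq z 0.
    by rewrite invr0 mulr0 ler01.
  by rewrite ler_pdivrMr ?mul1r // lt_neqAle eq_sym zn0.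
have fracK z : 0 <= z -> k <= z -> z * (k / z) = k.
  move=> z0 kz; have [z_0|zn0] := eqVneq z 0.
    by rewrite z_0 mul0r; apply/eqP; rewrite eq_le k0 -z_0 kz.
  by rewrite mulrCA divff ?mulr1.
have a0 x : 0 <= a x <= gam x v.
  rewrite /a; case: eqP => _; first by rewrite lexx gam0.
  case/andP: (frac _ inn0 k_inn) => ? ?.
  by rewrite mulr_ge0 // ler_piMr.
have c0 y : 0 <= c y <= gam v y.
  rewrite /c; case: eqP => _; first by rewrite lexx gam0.
  case/andP: (frac _ out0 k_out) => ? ?.
  by rewrite mulr_ge0 // ler_piMr.
have sum_a : \sum_x a x = k.
  rewrite -(fracK inn) // /inn mulr_suml [RHS]big_mkcond; apply: eq_bigr => x _.
  by rewrite /a; case: eqP.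
have sum_c : \sum_y c y = k.
  rewrite -(fracK out) // /out mulr_suml [RHS]big_mkcond; apply: eq_bigr => y _.
  by rewrite /c; case: eqP.
have av : a v = 0 by rewrite /a eqxx.
have cv : c v = 0 by rewrite /c eqxx.
have az x : k = 0 -> a x = 0.
  by rewrite /a => ->; rewrite !mul0r mulr0; case: eqP.
have cz y : k = 0 -> c y = 0.
  by rewrite /c => ->; rewrite !mul0r mulr0; case: eqP.
have aK x : a x / k * k = a x.
  by have [k_0|kn0] := eqVneq k 0; [rewrite az ?mul0r | rewrite divfK].
have cK y : k / k * c y = c y.
  by have [k_0|kn0] := eqVneq k 0; [rewrite cz // mulr0 | rewrite divff ?mul1r].
pose del x : R := (x == v)%:R.
have sum_del (f : V -> R) : \sum_x del x * f x = f v := sum_deltaM v f.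
have sum_del1 : \sum_x del x = 1 by rewrite sum_delta.
pose gam' x y := gam x y - a x * del y - del x * c y + a x / k * c y
  + del x * (del y * (dv - gam v v)).
have row x : \sum_y gam' x y =
    \sum_y gam x y - del x * (k - (dv - gam v v)).
  rewrite !(sumrB, big_split) /= -!mulr_sumr sum_c aK.
  by rewrite sum_del1 -mulr_suml sum_del1; ring.
have col y : \sum_x gam' x y =
    \sum_x gam x y - del y * (k - (dv - gam v v)).
  rewrite !(sumrB, big_split) /= -!mulr_suml sum_a.
  by rewrite cK !sum_del1; ring.
exists gam'; split.
- split=> [x y|x]; last by rewrite row col -gamE; ring.
  rewrite /gam' /del; have := a0 x; have := c0 y.
  have quot : 0 <= a x / k * c y.
    case/andP: (a0 x) => ? _; case/andP: (c0 y) => ? _.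
    by rewrite mulr_ge0 ?divr_ge0.
  case: (eqVneq x v) => [->|_]; case: (eqVneq y v) => [->|_] /=.
  + by rewrite av cv; lra.
  + by rewrite av !(mul0r, mul1r, mulr0); lra.
  + by rewrite cv !(mul0r, mul1r, mulr0, mulr1); lra.
  + by have := gam0 x y; rewrite !(mul0r, mul1r, mulr0, mulr1); lra.
- rewrite /transport_cost.
  have via x y : a x / k * c y * d x y <=
      a x / k * c y * d x v + a x / k * c y * d v y.
    case/andP: (a0 x) => ? _; case/andP: (c0 y) => ? _.
    by rewrite -mulrDr ler_wpM2l // mulr_ge0 ?divr_ge0.
  have sum_in : \sum_x \sum_y a x / k * c y * d x v = \sum_x a x * d x v.
    apply: eq_bigr => x _; rewrite -mulr_suml -mulr_sumr sum_c.
    by rewrite aK.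
  have sum_out : \sum_x \sum_y a x / k * c y * d v y = \sum_y c y * d v y.
    rewrite exchange_big; apply: eq_bigr => y _ /=.
    rewrite -mulr_suml; congr (_ * _); rewrite -mulr_suml -mulr_suml sum_a.
    exact: cK.
  apply: (@le_trans _ _ (\sum_x \sum_y (gam x y * d x y - del y * (a x * d x y)
      - del x * (c y * d x y)
      + (a x / k * c y * d x v + a x / k * c y * d v y)
      + del y * (del x * (dv - gam v v) * d x y)))).
    apply: ler_sum => x _; apply: ler_sum => y _.
    by have := via x y; rewrite /gam'; move: (a x / k * c y) => m; lra.
  rewrite le_eqVlt; apply/orP; left; apply/eqP.
  under eq_bigr => x _.
    rewrite !(sumrB, big_split) /= !sum_del -mulr_sumr.
    over.
  rewrite !(sumrB, big_split) /= sum_in sum_out sum_del.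
  under [X in _ + X]eq_bigr do rewrite -mulrA.
  by rewrite sum_del dxx; ring.
- rewrite row /del eqxx mul1r (bigD1 v) //= -/out /dv; ring.
- by move=> x /negPf xv; rewrite row /del xv mul0r subr0.
Qed.

(** Eliminating the vertices one after another gives a coupling, since the
    vertices already treated are left in balance. *)
Lemma transshipment mu nu d gam :
  (forall x, 0 <= mu x) -> (forall x, 0 <= nu x) ->
  (forall x, d x x = 0) -> (forall x y z, d x z <= d x y + d y z) ->
  shipment mu nu gam ->
  exists2 pi, [/\ forall x y, 0 <= pi x y, forall x, \sum_y pi x y = mu x
                & forall y, \sum_x pi x y = nu y]
            & transport_cost d pi <= transport_cost d gam.
Proof.
move=> mu0 nu0 dxx dtri shipgam.
suff [pi [[pi0 piE] le_pi rows]] : exists pi, [/\ shipment mu nu pi,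
    transport_cost d pi <= transport_cost d gam
  & forall x, x \in enum V -> \sum_y pi x y = mu x].
  have rowE x : \sum_y pi x y = mu x by apply: rows; rewrite mem_enum.
  by exists pi => //; split=> // y; have := piE y; rewrite rowE; lra.
elim: (enum V) => [|v s [pi [shippi le_pi rows]]]; first by exists gam.
have [pi' [ship' le' rowv row']] := eliminate_vertex v mu0 nu0 dxx dtri shippi.
exists pi'; split=> // [|x]; first exact: le_trans le' le_pi.
rewrite inE; have [->|xv] := eqVneq x v; first by rewrite rowv.
by rewrite /= row' //; apply: rows.
Qed.

End Transshipment.

(** * The Wasserstein cost of a graph and of a tree *)

Section Wasserstein.
Variables (R : realType) (V : finType).
Implicit Types (E T : {set {set V}}) (x y z : V) (mu nu phi : V -> R).

Lemma dist_refl E x : dist E x x = 0%N.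
Proof. by apply/eqP; rewrite -leqn0 (@dist_le _ E x [::]). Qed.

Lemma dist_triangle E x y z : connected_graph E ->
  (dist E x z <= dist E x y + dist E y z)%N.
Proof.
move=> conE; have /existsP[p /andP[pathp /eqP lastp]] := dist_walk (conE x y).
have /existsP[q /andP[pathq /eqP lastq]] := dist_walk (conE y z).
have := @dist_le _ E x (p ++ q); rewrite cat_path pathp lastp pathq last_cat.
by rewrite lastp lastq size_cat !size_tuple; apply.
Qed.

Lemma dist_sub E T x y : T \subset E -> connected_graph T ->
  (dist E x y <= dist T x y)%N.
Proof.
move=> sTE conT.
have /existsP[p /andP[pathp /eqP lastp]] := dist_walk (conT x y).
have := @dist_le _ E x p; rewrite lastp size_tuple; apply.
by apply: sub_path pathp => a b; apply: (fintype.subsetP sTE).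
Qed.

Lemma dist_adj E x y : adj E x y -> (dist E x y <= 1)%N.
Proof. by move=> Exy; apply: (@dist_le _ E x [:: y]); rewrite /= Exy. Qed.

(** Add up the Lipschitz bounds along a shortest walk. *)
Lemma lip_dist E phi x y : connected_graph E ->
  (forall x y, adj E x y -> `|phi x - phi y| <= 1) ->
  phi x - phi y <= (dist E x y)%:R.
Proof.
move=> conE lip.
have /existsP[p /andP[pathp /eqP lastp]] := dist_walk (conE x y).
case: p pathp lastp => q /= /eqP size_q pathq lastq.
rewrite -{}size_q -{}lastq; move: pathq.
elim: q x => [|z q IHq] u /=; first by rewrite subrr.
case/andP=> /lip uz /IHq {}IHq; rewrite -natr1 addrC.
have := le_trans (ler_norm _) uz; lra.
Qed.

Lemma coupling_prod mu nu : density mu -> density nu ->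
  coupling mu nu (fun x y => mu x * nu y).
Proof.
move=> [mu0 mu1] [nu0 nu1]; split=> [x y|x|y]; first by rewrite mulr_ge0.
  by rewrite -mulr_sumr nu1 mulr1.
by rewrite -mulr_suml mu1 mul1r.
Qed.

(** The product coupling makes the infimum one over a nonempty set. *)
Lemma wasserstein_ge E mu nu (m : R) : density mu -> density nu ->
  (forall pi, coupling mu nu pi ->
     m <= transport_cost (fun x y => (dist E x y)%:R) pi) ->
  m <= wasserstein E mu nu.
Proof.
move=> dmu dnu le_m; apply: lb_le_inf.
  by eexists; eexists; [apply: coupling_prod dmu dnu|].
by move=> _ [pi cpi ->]; apply: le_m.
Qed.

Lemma wasserstein_le E mu nu pi : coupling mu nu pi ->
  wasserstein E mu nu <= transport_cost (fun x y => (dist E x y)%:R) pi.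
Proof.
move=> cpi; apply: ge_inf; last by exists pi.
exists 0 => _ [rho [rho0 _ _] ->]; apply: sumr_ge0 => x _.
by apply: sumr_ge0 => y _; rewrite mulr_ge0.
Qed.

Lemma wasserstein_sub E T mu nu : density mu -> density nu ->
  T \subset E -> connected_graph T ->
  wasserstein E mu nu <= wasserstein T mu nu.
Proof.
move=> dmu dnu sTE conT; apply: wasserstein_ge => // pi cpi.
apply: le_trans (wasserstein_le E cpi) _; case: cpi => pi0 _ _.
apply: ler_sum => x _; apply: ler_sum => y _; rewrite ler_wpM2l // ler_nat.
exact: dist_sub.
Qed.

(** The easy half of Kantorovich duality. *)
Lemma wasserstein_dual E mu nu phi : density mu -> density nu ->
  connected_graph E -> (forall x y, adj E x y -> `|phi x - phi y| <= 1) ->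
  \sum_v (mu v - nu v) * phi v <= wasserstein E mu nu.
Proof.
move=> dmu dnu conE lip; apply: wasserstein_ge => // pi [pi0 pi_mu pi_nu].
have -> : \sum_v (mu v - nu v) * phi v =
    transport_cost (fun x y => phi x - phi y) pi.
  rewrite /transport_cost.
  under [RHS]eq_bigr do under eq_bigr do rewrite mulrBr.
  under [RHS]eq_bigr do rewrite sumrB -mulr_suml pi_mu.
  rewrite sumrB exchange_big /= -sumrB; apply: eq_bigr => v _.
  by rewrite -mulr_suml pi_nu mulrBl.
apply: ler_sum => x _; apply: ler_sum => y _; rewrite ler_wpM2l //.
exact: lip_dist.
Qed.

(** The positive part of a flow is a shipment along edges, each of length at
    most 1. *)
Lemma wasserstein_flow T mu nu F : density mu -> density nu ->
  connected_graph T -> flow T (fun v => mu v - nu v) F ->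
  wasserstein T mu nu <= cost F.
Proof.
move=> [mu0 _] [nu0 _] conT [FN F0 Fb].
pose gam x y : R := Num.max 0 (F x y).
have gamB x y : gam x y - gam y x = F x y.
  rewrite /gam (FN x y); have [Fpos|Fneg] := leP 0 (F x y).
    by rewrite max_l ?oppr_le0 // subr0.
  by rewrite max_r ?oppr_ge0 ?ltW // sub0r opprK.
have shipgam : shipment mu nu gam.
  split=> [x y|x]; first by rewrite le_max lexx.
  by rewrite -sumrB -Fb; apply: eq_bigr => y _.
pose d x y : R := (dist T x y)%:R.
have [||pi cpi le_pi] := transshipment (d := d) mu0 nu0 _ _ shipgam.
- by move=> x; rewrite /d dist_refl.
- by move=> x y z; rewrite /d -natrD ler_nat dist_triangle.
apply: le_trans (wasserstein_le T cpi) _; apply: le_trans le_pi _.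
apply: (@le_trans _ _ (\sum_x \sum_y gam x y)).
  apply: ler_sum => x _; apply: ler_sum => y _.
  have [Txy|nTxy] := boolP (adj T x y).
    rewrite ler_piMr ?le_max ?lexx // -[leRHS]/(1%:R) ler_nat.
    exact: dist_adj.
  by rewrite /gam F0 // maxxx mul0r.
rewrite /cost ler_pdivlMr ?ltr0n // mulr_natr mulr2n {2}exchange_big -big_split.
apply: ler_sum => x _; rewrite -big_split; apply: ler_sum => y _ /=.
rewrite /gam (FN x y); have [Fpos|Fneg] := leP 0 (F x y).
  by rewrite max_l ?oppr_le0 // addr0 ger0_norm.
by rewrite max_r ?oppr_ge0 ?(ltW Fneg) // add0r ltr0_norm.
Qed.

Lemma density_diff mu nu : density mu -> density nu -> \sum_v (mu v - nu v) = 0.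
Proof. by move=> [_ mu1] [_ nu1]; rewrite sumrB mu1 nu1 subrr. Qed.

Lemma wasserstein_tree T mu nu : density mu -> density nu -> tree T ->
  wasserstein T mu nu = tree_cost T (fun v => mu v - nu v).
Proof.
move=> dmu dnu treeT; have b0 := density_diff dmu dnu.
apply/eqP; rewrite eq_le; apply/andP; split.
  exact: wasserstein_flow treeT.1 (tree_flowP treeT b0).
rewrite -flow_sign_cost; apply: wasserstein_dual treeT.1 _ => // x y.
exact: flow_sign_lip.
Qed.

End Wasserstein.

(** * Basins are optimal *)

Theorem theorem1p5 (R : realType) (V : finType) (E : {set {set V}})
    (simpleE : simple_graph E) (connE : connected_graph E)
    (mu nu : V -> R) (dmu : density mu) (dnu : density nu)
    (X : {set {set {set V}}}) (c : R)
    (basinX : basin E (fun T => wasserstein T mu nu) c X) :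
  c = wasserstein E mu nu.
Proof.
case: basinX => X0 treeX _ levelX boundX.
pose b v := mu v - nu v; have b0 : \sum_v b v = 0 by apply: density_diff.
have [r _] : exists r : V, r \in V.
  apply/existsP; rewrite -[X in is_true X]negbK negb_exists.
  apply/negP=> /forallP nV; have [_ mu1] := dmu.
  move: mu1; rewrite big1 => [|v _]; last by case/negP: (nV v).
  by move/eqP; rewrite eq_sym oner_eq0.
have [b' [b'0 b'neq0 b'sg b'lt]] := generic_perturbation r b0.
have [T0 XT0] := set0Pn _ X0.
case: (Order.TotalTheory.arg_minP (fun T => tree_cost T b') XT0) => T XT minT.
have stT := treeX _ XT; have [sTE treeT] := (spanning_treeP T simpleE).1 stT.
have levelT : tree_cost T b = c by rewrite -wasserstein_tree ?levelX.
(* The potential is built from b' but certifies optimality for b. *)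
pose phi := potential T (flow_sign T b').
have phi_b : \sum_v b v * phi v = c.
  rewrite -levelT; apply: tree_cost_potential => x y.
  rewrite /flow_sign /tree_flow; case: ifP => _; first exact: b'sg.
  by rewrite sgr0 mul0r normr0.
have b'flow u w : adj T u w -> tree_flow T b' u w != 0.
  move=> Tuw; rewrite /tree_flow Tuw b'neq0 //.
    by apply/set0Pn; exists u; apply: mem_side.
  by apply: contraNneq (treeT.2 _ _ Tuw) => ->; rewrite inE.
have lip x y : adj E x y -> phi x - phi y <= 1.
  move=> Exy; have [Txy|nTxy] := boolP (adj T x y).
    exact: le_trans (ler_norm _) (flow_sign_lip treeT b'0 Txy).
  (* Otherwise a pivot gives a neighbour of T that is strictly cheaper for b',
     hence not in X, hence strictly more expensive for b. *)
  rewrite leNgt; apply/negP => gt1.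
  have [u [w [Tuw treeS ltS]]] := pivot treeT b'0 b'flow nTxy gt1.
  set S := _ :\ _ in treeS ltS.
  have sSE : S \subset E.
    apply: fintype.subset_trans (subD1set _ _) _.
    by rewrite subUset sTE sub1set.
  have stS : spanning_tree E S by apply/spanning_treeP.
  have nXS : S \notin X by apply: contraL ltS => /minT; rewrite -leNgt.
  have /boundX : boundary E X S.
    split=> //; exists T => //; apply/andP; split.
      by apply: contraNneq nXS => ->.
    apply/existsP; exists [set x; y]%SET.
    apply/andP; split; first by rewrite in_setD; apply/andP.
    by apply/existsP; exists [set u; w]%SET; rewrite [_ \in T]Tuw eqxx.
  rewrite wasserstein_tree // -levelT => /b'lt.
  by rewrite ltNge (ltW ltS).
apply/eqP; rewrite eq_le; apply/andP; split.
  rewrite -phi_b; apply: wasserstein_dual => // x y Exy.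
  by rewrite ler_norml lip // andbT lerNl opprB lip // adjC.
by rewrite -(levelX _ XT); apply: wasserstein_sub treeT.1.
Qed.
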